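(* Let $(H,[-,-,-])$ be a Hopf heap, let $(M,\rhd,\rho)$ be a left $H$-Hopf heap module, let $x\in G(H)$, and put $M^{coH}_x=\{m\in M:\ \rho(m)=x\otimes m\}$. Then there exists an isomorphism of left $H$-Hopf heap modules $$M\cong H\otimes M^{coH}_x,$$ where $H\otimes M^{coH}_x$ carries the action $(h\otimes g)\rhd(l\otimes m)=[h,g,l]\otimes m$ and the coaction $h\otimes m\mapsto h_1\otimes h_2\otimes m$.
   Context: Everything is over a fixed field $\mathbf{k}$. Sweedler notation $\Delta(c)=c_1\otimes c_2$ is used; $C^{cop}$ is the co-opposite coalgebra; $G(C)$ is the set of group-like elements of a coalgebra $C$ (assumed non-empty). A Hopf heap is a coalgebra $C$ with a coalgebra map $C\otimes C^{cop}\otimes C\to C$, $a\otimes b\otimes c\mapsto[a,b,c]$, such that $[[a,b,c],d,h]=[a,b,[c,d,h]]$ and $[c_1,c_2,a]=[a,c_1,c_2]=\varepsilon(c)a$ for all $a,b,c,d,h\in C$. A left $H$-Hopf heap module over a Hopf heap $H$ is a left $H$-comodule $(M,\rho)$, $\rho(m)=m_{(-1)}\otimes m_{(0)}$, with a linear map $\rhd:H\otimes H^{cop}\otimes M\to M$, written $(c\otimes d)\rhd m$, such that for all $a,b,c,d\in H$, $m\in M$: $([a,b,c]\otimes d)\rhd m=(a\otimes b)\rhd((c\otimes d)\rhd m)$; $(c_1\otimes c_2)\rhd m=\varepsilon(c)m$; $\rho((c\otimes d)\rhd m)=[c_1,d_2,m_{(-1)}]\otimes(c_2\otimes d_1)\rhd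 m_{(0)}$. A morphism of left $H$-Hopf heap modules $f:M\to N$ is a left $H$-comodule map with $f((a\otimes b)\rhd m)=(a\otimes b)\rhd f(m)$ for all $a,b\in H$, $m\in M$. *)

(* Defs.v *)
From HB Require Import structures.
From mathcomp Require Import all_boot all_order all_algebra.
From mathcomp Require Import boolp.
From mathcomp.finmap Require Import finmap.
From mathcomp.multinomials Require Import monalg.

Set Implicit Arguments.
Unset Strict Implicit.
Unset Printing Implicit Defensive.

Import GRing.Theory.
Local Open Scope ring_scope.
Local Open Scope quotient_scope.

Reserved Notation "U ⊗ V" (at level 40, left associativity).
Reserved Notation "⟦ a , b , c ⟧" (at level 0).
Reserved Notation "\sw_ ( x , y <- t ) F"
  (at level 41, F at level 41, x name, y name, t at level 50,
   format "'[' \sw_ ( x ,  y  <-  t ) '/  '  F ']'").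

(* The tensor product over k: the free vector space on U * V modulo the
   subspace bilin_rel generated by the bilinearity relations. *)
Section TensorDef.
Variables (k : fieldType) (U V : lmodType k).

Definition free_pairs := {malg k[(U * V)%type]}.
HB.instance Definition _ := GRing.Lmodule.on free_pairs.

Inductive bilin_rel : free_pairs -> Prop :=
| bilin_rel0 : bilin_rel 0
| bilin_rel_comb a x y : bilin_rel x -> bilin_rel y -> bilin_rel (a *: x + y)
| bilin_rel_l a u u' v :
    bilin_rel (<< (a *: u + u', v) >> - (a *: << (u, v) >> + << (u', v) >>))
| bilin_rel_r a u v v' :
    bilin_rel (<< (u, a *: v + v') >> - (a *: << (u, v) >> + << (u, v') >>)).

Definition bilin_relb : {pred free_pairs} := fun x => `[< bilin_rel x >].

Fact bilin_relb_submod : submod_closed bilin_relb.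
Proof.
split; first exact/asboolP/bilin_rel0.
by move=> a x y /asboolP Rx /asboolP Ry; apply/asboolP/bilin_rel_comb.
Qed.

HB.instance Definition _ :=
  GRing.isSubmodClosed.Build k free_pairs bilin_relb bilin_relb_submod.

Definition tensor : Type := ring_quotient.Quotient.quot bilin_relb.
HB.instance Definition _ := GRing.Zmodule.on tensor.
HB.instance Definition _ := Quotient.on tensor.

Definition tclass (x : free_pairs) : tensor := \pi_tensor x.

Definition tscale (a : k) (t : tensor) : tensor := tclass (a *: (repr t : free_pairs)).

Lemma tclassK t : tclass (repr t) = t. Proof. exact: reprK. Qed.

Lemma tclassD x y : tclass (x + y) = tclass x + tclass y.
Proof. exact: raddfD. Qed.

Lemma tclass0 : tclass 0 = 0.
Proof. exact: raddf0. Qed.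

Lemma tclass_eq x y : bilin_rel (x - y) <-> tclass x = tclass y.
Proof.
split=> [h|/eqP].
  by apply/eqP; rewrite -ring_quotient.Quotient.idealrBE; apply/asboolP.
by rewrite -ring_quotient.Quotient.idealrBE => /asboolP.
Qed.

Lemma tscale_class a x : tscale a (tclass x) = tclass (a *: x).
Proof.
apply/tclass_eq; rewrite -scalerBr -[X in bilin_rel X]addr0.
by apply: bilin_rel_comb bilin_rel0; apply/tclass_eq; rewrite tclassK.
Qed.

End TensorDef.
Arguments tensor {k} (U V)%_type_scope.
Section TensorLmod.
Variables (k : fieldType) (U V : lmodType k).
Local Notation T := (tensor U V).

Fact tscaleA a b (t : T) : tscale a (tscale b t) = tscale (a * b) t.
Proof. by rewrite -[t]tclassK !tscale_class scalerA. Qed.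
Fact tscale1 : left_id 1 (@tscale k U V).
Proof. by move=> t; rewrite -[t]tclassK tscale_class scale1r. Qed.
Fact tscaleDr : right_distributive (@tscale k U V) +%R.
Proof.
move=> a s t; rewrite -[s]tclassK -[t]tclassK -tclassD !tscale_class.
by rewrite scalerDr tclassD.
Qed.
Fact tscaleDl (t : T) : {morph (@tscale k U V)^~ t : a b / a + b}.
Proof. by move=> a b; rewrite -[t]tclassK !tscale_class scalerDl tclassD. Qed.

HB.instance Definition _ :=
  GRing.Zmodule_isLmodule.Build k T tscaleA tscale1 tscaleDr tscaleDl.
End TensorLmod.

HB.lock Definition tens (k : fieldType) (U V : lmodType k) (u : U) (v : V) :
  tensor U V := tclass << (u, v) >>.

Notation "U ⊗ V" := (tensor U V) : type_scope.
Notation "u ⊗ v" := (tens u v) : ring_scope.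

Notation is_bilinear f := (bilinear_for *:%R *:%R f).

(* The value at t of the linear map induced on U ⊗ V by the bilinear map f,
   i.e. the sum of the f u_i v_i for any decomposition of t as a sum of
   u_i ⊗ v_i (tliftE, tlift_linear; tlift is only meaningful for bilinear f).
   Hence \sw_(c1, c2 <- comul c) F is Sweedler's notation for a sum over
   comul c = c1 ⊗ c2. *)
HB.lock Definition tlift (k : fieldType) (U V W : lmodType k) (f : U -> V -> W)
    (t : U ⊗ V) : W :=
  let r : free_pairs U V := repr t in
  \sum_(p <- msupp r) r@_p *: f p.1 p.2.

Notation "\sw_ ( x , y <- t ) F" := (tlift (fun x y => F) t) : ring_scope.

Section TensorTheory.
Variables (k : fieldType) (U V W : lmodType k).
Implicit Types (f : U -> V -> W) (t : U ⊗ V).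

Let tensE u v : @tens k U V u v = tclass << (u, v) >>.
Proof. by rewrite tens.unlock. Qed.

Let ext f (x : free_pairs U V) : W := \sum_(p <- msupp x) x@_p *: f p.1 p.2.

Let extEw f (D : {fset U * V}) (x : free_pairs U V) : (msupp x `<=` D)%fset ->
  ext f x = \sum_(p <- D) x@_p *: f p.1 p.2.
Proof.
move=> sD; rewrite /ext (big_fset_incl _ sD) // => p _ /mcoeff_outdom ->.
by rewrite scale0r.
Qed.

Let ext_linear f a x y : ext f (a *: x + y) = a *: ext f x + ext f y.
Proof.
pose D := (msupp x `|` msupp y)%fset.
rewrite (@extEw f D x) ?fsubsetUl // (@extEw f D y) ?fsubsetUr //.
rewrite (@extEw f D (a *: x + y)).
  rewrite scaler_sumr -big_split /=; apply: eq_bigr => p _.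
  by rewrite mcoeffD mcoeffZ scalerDl scalerA.
apply: fsubset_trans (msuppD_le _ _) _; rewrite fsetSU //.
exact: msuppZ_le.
Qed.

Let ext_pure f u v : ext f << (u, v) >> = f u v.
Proof.
by rewrite (@extEw f [fset (u, v)]%fset) ?msuppU_le // big_seq_fset1 mcoeffUU
   scale1r.
Qed.

Let ext_rel f x : is_bilinear f -> bilin_rel x -> ext f x = 0.
Proof.
move=> fB.
have ext0 : ext f 0 = 0 by rewrite /ext msupp0 big_seq_fset0.
have extB y z : ext f (y - z) = ext f y - ext f z.
  by rewrite -(scaleN1r z) addrC ext_linear scaleN1r addrC.
elim=> {x} [//|a x y _ Ex _ Ey|a u u' v|a u v v'].
- by rewrite ext_linear Ex Ey scaler0 addr0.
- by rewrite extB ext_linear !ext_pure (fB.1 v) subrr.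
- by rewrite extB ext_linear !ext_pure (fB.2 u) subrr.
Qed.

Let tlift_class f x : is_bilinear f -> tlift f (tclass x) = ext f x.
Proof.
move=> fB; have /(ext_rel fB) : bilin_rel (repr (tclass x) - x).
  by apply/tclass_eq; rewrite tclassK.
rewrite -(scaleN1r x) addrC ext_linear scaleN1r addrC => /eqP.
by rewrite subr_eq0 tlift.unlock => /eqP.
Qed.

Lemma tliftE f u v : is_bilinear f -> tlift f (u ⊗ v) = f u v.
Proof. by move=> fB; rewrite tensE tlift_class ?ext_pure. Qed.

Lemma tlift_linear f : is_bilinear f -> linear (tlift f).
Proof.
move=> fB a s t; rewrite -[s]tclassK -[t]tclassK.
have -> : a *: tclass (repr s) = tclass (a *: repr s).
  exact: tscale_class.
by rewrite -tclassD !tlift_class // ext_linear.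
Qed.

Lemma tens_bilinear : is_bilinear (@tens k U V).
Proof.
split=> [v a u u'|u a v v'] /=; rewrite !tensE.
  transitivity (tclass (a *: << (u, v) >> + << (u', v) >>)).
    exact/tclass_eq/bilin_rel_l.
  by rewrite tclassD -tscale_class.
transitivity (tclass (a *: << (u, v) >> + << (u, v') >>)).
  exact/tclass_eq/bilin_rel_r.
by rewrite tclassD -tscale_class.
Qed.

Lemma tensZl (a : k) (u : U) (v : V) : (a *: u) ⊗ v = a *: (u ⊗ v).
Proof. exact: (scalable_linear (tens_bilinear.1 v)). Qed.

Lemma tensZr (a : k) (u : U) (v : V) : u ⊗ (a *: v) = a *: (u ⊗ v).
Proof. exact: (scalable_linear (tens_bilinear.2 u)). Qed.

Lemma tensor_ind (P : U ⊗ V -> Prop) : P 0 ->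
  (forall a u v t, P t -> P (a *: (u ⊗ v) + t)) -> forall t, P t.
Proof.
move=> P0 Pc t; rewrite -[t]tclassK (monalgE (repr t : free_pairs U V)).
elim: (enum_fset (msupp _)) => [|p s IH]; first by rewrite big_nil tclass0.
rewrite big_cons tclassD.
have -> : << (repr t)@_p *g p >> = (repr t)@_p *: << p >> :> free_pairs U V.
  by apply/malgP => q; rewrite mcoeffZ !mcoeffU mulr_natr.
by rewrite -tscale_class [in << p >>](surjective_pairing p) -tensE; apply: Pc.
Qed.

Lemma tensor_ext (f g : U ⊗ V -> W) : linear f -> linear g ->
  (forall u v, f (u ⊗ v) = g (u ⊗ v)) -> f =1 g.
Proof.
move=> fL gL fg; elim/tensor_ind => [|a u v t IH].
  have z (h : U ⊗ V -> W) : linear h -> h 0 = 0.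
    by move=> hL; move: (hL (-1) 0 0); rewrite !scaleN1r !addNr.
  by rewrite !z.
by rewrite fL gL fg IH.
Qed.

End TensorTheory.
Section TliftTheory.
Variables (k : fieldType).

Lemma eq_tlift (U V W : lmodType k) (f g : U -> V -> W) (t : U ⊗ V) :
  (forall u v, f u v = g u v) -> tlift f t = tlift g t.
Proof. by move=> fg; rewrite tlift.unlock /=; apply: eq_bigr => p _; rewrite fg. Qed.

Lemma linear_tlift (U V W X : lmodType k) (h : W -> X) (f : U -> V -> W)
    (t : U ⊗ V) :
  linear h -> h (tlift f t) = \sw_(u, v <- t) h (f u v).
Proof.
move=> hL; have h0 : h 0 = 0.
  by move: (hL (-1) 0 0); rewrite !scaleN1r !addNr.
rewrite tlift.unlock /=; elim: (enum_fset _) => [|p s IH]; first by rewrite !big_nil.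
by rewrite !big_cons hL IH.
Qed.

Lemma tlift_exchange (U V U' V' W : lmodType k) (f : U -> V -> U' -> V' -> W)
    (t : U ⊗ V) (s : U' ⊗ V') :
  \sw_(u, v <- t) \sw_(u', v' <- s) f u v u' v' =
  \sw_(u', v' <- s) \sw_(u, v <- t) f u v u' v'.
Proof.
rewrite tlift.unlock /=; under eq_bigr do rewrite scaler_sumr.
rewrite exchange_big /=; apply: eq_bigr => p _; rewrite scaler_sumr.
by apply: eq_bigr => q _; rewrite !scalerA mulrC.
Qed.

Lemma linear_id (U : lmodType k) : linear (fun x : U => x).
Proof. by []. Qed.

Lemma linear_comp (U V W : lmodType k) (f : V -> W) (g : U -> V) :
  linear f -> linear g -> linear (fun x => f (g x)).
Proof. by move=> fL gL a x y; rewrite gL fL. Qed.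

Lemma linear_fun (U V : lmodType k) (f : {linear U -> V}) : linear f.
Proof. exact: linearP. Qed.

Lemma linear_tensl (U V X : lmodType k) (g : X -> U) (v : V) :
  linear g -> linear (fun x => g x ⊗ v).
Proof. by move=> gL a x y; rewrite gL (tens_bilinear U V).1. Qed.

Lemma linear_tensr (U V X : lmodType k) (g : X -> V) (u : U) :
  linear g -> linear (fun x => u ⊗ g x).
Proof. by move=> gL a x y; rewrite gL (tens_bilinear U V).2. Qed.

Lemma linear_scale (U X : lmodType k) (g : X -> U) b :
  linear g -> linear (fun x => b *: g x).
Proof. by move=> gL a x y; rewrite gL scalerDr !scalerA mulrC. Qed.

Lemma linear_scalel (U X : lmodType k) (g : X -> k) (u : U) :
  scalar g -> linear (fun x => g x *: u).
Proof. by move=> gL a x y; rewrite gL scalerDl scalerA. Qed.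

Lemma linear_body (U V W X : lmodType k) (F : X -> U -> V -> W) (t : U ⊗ V) :
  (forall u v, linear (fun x => F x u v)) ->
  linear (fun x => \sw_(u, v <- t) F x u v).
Proof.
move=> FL a x y; rewrite tlift.unlock /= scaler_sumr -big_split /=.
by apply: eq_bigr => p _; rewrite FL scalerDr !scalerA mulrC.
Qed.

Lemma linear_arg (U V W X : lmodType k) (f : U -> V -> W) (g : X -> U ⊗ V) :
  (forall v, linear (fun u => f u v)) -> (forall u, linear (f u)) ->
  linear g -> linear (fun x => tlift f (g x)).
Proof. by move=> fl fr gL; apply: linear_comp gL; apply: tlift_linear. Qed.

End TliftTheory.

(* Closes linear and is_bilinear goals on compositions of tlift, tens, *: and
   linear functions. *)
Ltac lin := first
  [ assumption | exact: linear_id | exact: linearP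
  | match goal with
    | |- bilinear_for _ _ _ => split=> ? /=; lin
    | |- linear (fun x => tens (@?g x) ?v) => apply: linear_tensl; lin
    | |- linear (fun x => tens ?u (@?g x)) => apply: linear_tensr; lin
    | |- linear (fun x => tlift ?f (@?g x)) =>
        apply: linear_arg => [?|?|] /=; lin
    | |- linear (fun x => tlift (@?f x) ?t) =>
        apply: linear_body => ? ? /=; lin
    | |- linear (fun x => ?b *: (@?g x)) => apply: linear_scale; lin
    | |- linear (fun x => (@?g x) *: ?u) => apply: linear_scalel; lin
    | |- linear (tens ?u) => apply: (tens_bilinear _ _).2
    | |- linear (tlift _) => apply: tlift_linear; lin
    end
  | move=> ? ? ? /=; by rewrite ?linearP
  | apply: linear_comp; [exact: linear_fun | lin]
  ].

HB.mixin Record isCoalgebra (k : fieldType) C of GRing.Lmodule k C := {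
  comul : {linear C -> (C ⊗ C)%type};
  counit : {scalar C};
  comulA_subproof : forall c : C,
    \sw_(c1, c2 <- comul c) \sw_(c11, c12 <- comul c1) c11 ⊗ (c12 ⊗ c2) =
    \sw_(c1, c2 <- comul c) \sw_(c21, c22 <- comul c2) c1 ⊗ (c21 ⊗ c22);
  counitl : forall c : C, \sw_(c1, c2 <- comul c) counit c1 *: c2 = c;
  counitr : forall c : C, \sw_(c1, c2 <- comul c) counit c2 *: c1 = c
}.

#[short(type="coalgType")]
HB.structure Definition Coalgebra (k : fieldType) :=
  {C of isCoalgebra k C & GRing.Lmodule k C}.

Definition group_like (k : fieldType) (C : coalgType k) (x : C) : Prop :=
  comul x = x ⊗ x /\ counit x = 1.

Definition tmap (k : fieldType) (U V U' V' : lmodType k)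
    (f : U -> U') (g : V -> V') (t : U ⊗ V) : U' ⊗ V' :=
  \sw_(u, v <- t) f u ⊗ g v.

Definition coalg_morphism (k : fieldType) (C D : coalgType k)
    (f : {linear C -> D}) : Prop :=
  (forall c, comul (f c) = tmap f f (comul c)) /\
  (forall c, counit (f c) = counit c).

Section CoalgTheory.
Variables (k : fieldType) (C : coalgType k).

Lemma comulA (W : lmodType k) (G : C -> C -> C -> W) (c : C) :
  (forall b d, linear (fun a => G a b d)) ->
  (forall a d, linear (fun b => G a b d)) ->
  (forall a b, linear (fun d => G a b d)) ->
  \sw_(c1, c2 <- comul c) \sw_(c11, c12 <- comul c1) G c11 c12 c2 =
  \sw_(c1, c2 <- comul c) \sw_(c21, c22 <- comul c2) G c1 c21 c22.
Proof.
move=> G1 G2 G3; pose L := tlift (fun a => tlift (G a)).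
have BG a : is_bilinear (G a) by split=> b; [exact: G2 | exact: G3].
have BL : is_bilinear (fun a => tlift (G a)).
  split=> [t|a]; last exact: tlift_linear.
  by apply: linear_body => b d; apply: G1.
have LL : linear L by apply: tlift_linear.
have LE a b d : L (a ⊗ (b ⊗ d)) = G a b d by rewrite /L (tliftE _ _ BL) (tliftE _ _ (BG a)).
clearbody L.
have Lsw (t : C ⊗ C) (g : C -> C -> C ⊗ (C ⊗ C)) :
    L (tlift g t) = \sw_(u, v <- t) L (g u v) by apply: linear_tlift.
transitivity (L (\sw_(c1, c2 <- comul c)
    \sw_(c11, c12 <- comul c1) c11 ⊗ (c12 ⊗ c2))).
  rewrite Lsw; apply: eq_tlift => c1 c2; rewrite Lsw.
  by apply: eq_tlift => *; rewrite LE.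
rewrite comulA_subproof Lsw; apply: eq_tlift => c1 c2; rewrite Lsw.
by apply: eq_tlift => *; rewrite LE.
Qed.
End CoalgTheory.

Lemma tlift_tlift (k : fieldType) (U V U' V' W : lmodType k)
    (f : U -> V -> W) (g : U' -> V' -> U ⊗ V) (t : U' ⊗ V') :
  is_bilinear f -> tlift f (tlift g t) = \sw_(u, v <- t) tlift f (g u v).
Proof. by move=> fB; apply: linear_tlift; apply: tlift_linear. Qed.

Definition cop (k : fieldType) (C : coalgType k) : Type := C.

Section Cop.
Variables (k : fieldType) (C : coalgType k).

HB.instance Definition _ := GRing.Lmodule.on (cop C).

Definition cop_comul (c : cop C) : cop C ⊗ cop C :=
  \sw_(c1, c2 <- comul (c : C)) (c2 : cop C) ⊗ (c1 : cop C).

Fact cop_comul_linear : linear cop_comul.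
Proof. by rewrite /cop_comul; lin. Qed.

HB.instance Definition _ := GRing.isLinear.Build k (cop C) (cop C ⊗ cop C)%type
  *:%R cop_comul cop_comul_linear.

Lemma cop_comulE (W : lmodType k) (F : cop C -> cop C -> W) (c : cop C) :
  is_bilinear F ->
  tlift F (cop_comul c) = \sw_(c1, c2 <- comul (c : C)) F c2 c1.
Proof.
by move=> FB; rewrite tlift_tlift //; apply: eq_tlift => *; rewrite tliftE.
Qed.

Fact cop_comulA (c : cop C) :
  \sw_(c1, c2 <- cop_comul c) \sw_(c11, c12 <- cop_comul c1)
    c11 ⊗ (c12 ⊗ c2) =
  \sw_(c1, c2 <- cop_comul c) \sw_(c21, c22 <- cop_comul c2)
    c1 ⊗ (c21 ⊗ c22).
Proof.
rewrite !cop_comulE; [|lin|lin].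
transitivity (\sw_(c1, c2 <- comul (c : C)) \sw_(a, b <- comul c2)
    (b : cop C) ⊗ ((a : cop C) ⊗ (c1 : cop C))).
  by apply: eq_tlift => c1 c2; rewrite cop_comulE //; lin.
rewrite -(comulA (G := fun x y z : C =>
  (z : cop C) ⊗ ((y : cop C) ⊗ (x : cop C)))); [|move=> *; lin..].
by apply: eq_tlift => c1 c2; rewrite cop_comulE //; lin.
Qed.

Fact cop_counitl (c : cop C) :
  \sw_(c1, c2 <- cop_comul c) counit (c1 : C) *: c2 = c.
Proof. by rewrite cop_comulE; [apply: counitr | lin]. Qed.

Fact cop_counitr (c : cop C) :
  \sw_(c1, c2 <- cop_comul c) counit (c2 : C) *: c1 = c.
Proof. by rewrite cop_comulE; [apply: counitl | lin]. Qed.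

HB.instance Definition _ := isCoalgebra.Build k (cop C)
  cop_comulA cop_counitl cop_counitr.

End Cop.

Section TensorCoalg.
Variables (k : fieldType) (C D : coalgType k).

Definition tensor_comul (t : C ⊗ D) : (C ⊗ D) ⊗ (C ⊗ D) :=
  \sw_(c, d <- t) \sw_(c1, c2 <- comul c) \sw_(d1, d2 <- comul d)
    (c1 ⊗ d1) ⊗ (c2 ⊗ d2).

Definition tensor_counit (t : C ⊗ D) : k :=
  tlift (W := k^o) (fun c d => counit c * counit d) t.

Let counit2 : bilinear_for (V := k^o) *:%R *:%R
  (fun (c : C) (d : D) => counit c * counit d : k^o).
Proof.
split=> [d a c c'|c a d d'] /=; rewrite linearP.
  by rewrite mulrDl -mulrA.
by rewrite mulrDr mulrCA.
Qed.

Let comul2 : is_bilinear (fun (c : C) (d : D) =>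
  \sw_(c1, c2 <- comul c) \sw_(d1, d2 <- comul d) (c1 ⊗ d1) ⊗ (c2 ⊗ d2)).
Proof. lin. Qed.

Fact tensor_comul_linear : linear tensor_comul.
Proof. exact: tlift_linear comul2. Qed.

Fact tensor_counit_linear : scalar tensor_counit.
Proof. exact: (tlift_linear counit2). Qed.

HB.instance Definition _ := GRing.isLinear.Build k (C ⊗ D)%type
  ((C ⊗ D) ⊗ (C ⊗ D))%type *:%R tensor_comul tensor_comul_linear.

HB.instance Definition _ := GRing.isLinear.Build k (C ⊗ D)%type k *%R
  tensor_counit tensor_counit_linear.

Lemma tensor_comulE (W : lmodType k) (F : C ⊗ D -> C ⊗ D -> W) c d :
  is_bilinear F ->
  tlift F (tensor_comul (c ⊗ d)) =
  \sw_(c1, c2 <- comul c) \sw_(d1, d2 <- comul d) F (c1 ⊗ d1) (c2 ⊗ d2).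
Proof.
move=> FB; rewrite /tensor_comul tliftE // tlift_tlift //.
apply: eq_tlift => c1 c2; rewrite tlift_tlift //.
by apply: eq_tlift => d1 d2; rewrite tliftE.
Qed.

Lemma tensor_counitE c d : tensor_counit (c ⊗ d) = counit c * counit d.
Proof. by rewrite /tensor_counit tliftE. Qed.

Fact tensor_comulA (t : C ⊗ D) :
  \sw_(x1, x2 <- tensor_comul t) \sw_(x11, x12 <- tensor_comul x1)
    x11 ⊗ (x12 ⊗ x2) =
  \sw_(x1, x2 <- tensor_comul t) \sw_(x21, x22 <- tensor_comul x2)
    x1 ⊗ (x21 ⊗ x22).
Proof.
move: t; apply: tensor_ext => [||c d]; [lin|lin|].
rewrite !tensor_comulE; [|lin|lin].
transitivity (\sw_(c1, c2 <- comul c) \sw_(c11, c12 <- comul c1)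
    \sw_(d1, d2 <- comul d) \sw_(d11, d12 <- comul d1)
    (c11 ⊗ d11) ⊗ ((c12 ⊗ d12) ⊗ (c2 ⊗ d2))).
  apply: eq_tlift => c1 c2; rewrite [RHS]tlift_exchange.
  by apply: eq_tlift => d1 d2; rewrite tensor_comulE //; lin.
transitivity (\sw_(c1, c2 <- comul c) \sw_(c21, c22 <- comul c2)
    \sw_(d1, d2 <- comul d) \sw_(d21, d22 <- comul d2)
    (c1 ⊗ d1) ⊗ ((c21 ⊗ d21) ⊗ (c22 ⊗ d22))); last first.
  apply: eq_tlift => c1 c2; rewrite [LHS]tlift_exchange.
  by apply: eq_tlift => d1 d2; rewrite tensor_comulE //; lin.
rewrite -(comulA (G := fun x y z => \sw_(d1, d2 <- comul d)
  \sw_(d21, d22 <- comul d2) (x ⊗ d1) ⊗ ((y ⊗ d21) ⊗ (z ⊗ d22))));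
  [|move=> *; lin..].
apply: eq_tlift => c1 c2; apply: eq_tlift => c11 c12.
by apply: (comulA (G := fun x y z =>
  (c11 ⊗ x) ⊗ ((c12 ⊗ y) ⊗ (c2 ⊗ z)))) => *; lin.
Qed.

Fact tensor_counitl (t : C ⊗ D) :
  \sw_(x1, x2 <- tensor_comul t) tensor_counit x1 *: x2 = t.
Proof.
move: t; apply: tensor_ext => [||c d]; [lin|lin|].
rewrite tensor_comulE; last by lin.
rewrite -[RHS](congr2 (@tens k C D) (counitl c) (counitl d)).
rewrite (linear_tlift (h := fun x => x ⊗ _)); last by lin.
apply: eq_tlift => c1 c2.
rewrite (linear_tlift (h := fun x => _ ⊗ x)); last by lin.
apply: eq_tlift => d1 d2; rewrite tensor_counitE.
by rewrite tensZl tensZr scalerA.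
Qed.

Fact tensor_counitr (t : C ⊗ D) :
  \sw_(x1, x2 <- tensor_comul t) tensor_counit x2 *: x1 = t.
Proof.
move: t; apply: tensor_ext => [||c d]; [lin|lin|].
rewrite tensor_comulE; last by lin.
rewrite -[RHS](congr2 (@tens k C D) (counitr c) (counitr d)).
rewrite (linear_tlift (h := fun x => x ⊗ _)); last by lin.
apply: eq_tlift => c1 c2.
rewrite (linear_tlift (h := fun x => _ ⊗ x)); last by lin.
apply: eq_tlift => d1 d2; rewrite tensor_counitE.
by rewrite tensZl tensZr scalerA.
Qed.

HB.instance Definition _ := isCoalgebra.Build k (C ⊗ D)%type
  tensor_comulA tensor_counitl tensor_counitr.

End TensorCoalg.

(* The bracket is a linear map on C ⊗ C^cop ⊗ C; heap_bracket mu a b c is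
   [a, b, c], its value on a ⊗ b ⊗ c. *)
Definition heap_bracket (k : fieldType) (C : coalgType k)
    (mu : (C ⊗ cop C) ⊗ C -> C) (a b c : C) : C :=
  mu ((a ⊗ (b : cop C)) ⊗ c).

HB.mixin Record isHopfHeap (k : fieldType) H of Coalgebra k H := {
  heap_op : {linear ((H ⊗ cop H) ⊗ H)%type -> H};
  heap_op_coalg : coalg_morphism heap_op;
  heapA : forall a b c d h : H,
    heap_bracket heap_op (heap_bracket heap_op a b c) d h =
    heap_bracket heap_op a b (heap_bracket heap_op c d h);
  heapl : forall c a : H,
    \sw_(c1, c2 <- comul c) heap_bracket heap_op c1 c2 a = counit c *: a;
  heapr : forall c a : H,
    \sw_(c1, c2 <- comul c) heap_bracket heap_op a c1 c2 = counit c *: a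
}.

#[short(type="hopfHeapType")]
HB.structure Definition HopfHeap (k : fieldType) :=
  {H of isHopfHeap k H & Coalgebra k H}.

Notation "⟦ a , b , c ⟧" := (heap_bracket heap_op a b c) : ring_scope.

(* Left comodules; coact m is Sweedler's m_(-1) ⊗ m_(0). *)
HB.mixin Record isComodule (k : fieldType) (H : coalgType k) M
    of GRing.Lmodule k M := {
  coact : {linear M -> (H ⊗ M)%type};
  coactA_subproof : forall m : M,
    \sw_(h, n <- coact m) \sw_(h1, h2 <- comul h) h1 ⊗ (h2 ⊗ n) =
    \sw_(h, n <- coact m) h ⊗ coact n;
  counit_coact : forall m : M, \sw_(h, n <- coact m) counit h *: n = m
}.

#[short(type="comodType")]
HB.structure Definition Comodule (k : fieldType) (H : coalgType k) :=
  {M of isComodule k H M & GRing.Lmodule k M}.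

(* heap_act act c d m is (c ⊗ d) ▷ m, for the linear map act on
   H ⊗ H^cop ⊗ M. *)
Definition heap_act (k : fieldType) (H : coalgType k) (M : lmodType k)
    (act : (H ⊗ cop H) ⊗ M -> M) (c d : H) (m : M) : M :=
  act ((c ⊗ (d : cop H)) ⊗ m).

HB.mixin Record isHopfHeapModule (k : fieldType) (H : hopfHeapType k) M
    of Comodule k H M := {
  act : {linear ((H ⊗ cop H) ⊗ M)%type -> M};
  actA : forall (a b c d : H) (m : M),
    heap_act act ⟦a, b, c⟧ d m = heap_act act a b (heap_act act c d m);
  act_counit : forall (c : H) (m : M),
    \sw_(c1, c2 <- comul c) heap_act act c1 c2 m = counit c *: m;
  coact_act : forall (c d : H) (m : M),
    coact (heap_act act c d m) =
    \sw_(c1, c2 <- comul c) \sw_(d1, d2 <- comul d) \sw_(h, n <- coact m)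
      ⟦c1, d2, h⟧ ⊗ heap_act act c2 d1 n
}.

#[short(type="hopfHeapModType")]
HB.structure Definition HopfHeapModule (k : fieldType) (H : hopfHeapType k) :=
  {M of isHopfHeapModule k H M & Comodule k H M}.

Definition hopf_heap_mod_morphism (k : fieldType) (H : hopfHeapType k)
    (M N : hopfHeapModType H) (f : {linear M -> N}) : Prop :=
  (forall m, coact (f m) = tmap id f (coact m)) /\
  (forall a b m, f (heap_act act a b m) = heap_act act a b (f m)).

Definition hopf_heap_mod_isomorphic (k : fieldType) (H : hopfHeapType k)
    (M N : hopfHeapModType H) : Prop :=
  exists (f : {linear M -> N}) (g : {linear N -> M}),
    [/\ hopf_heap_mod_morphism f, hopf_heap_mod_morphism g,
        cancel f g & cancel g f].

Section Coinvariants.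
Variables (k : fieldType) (H : hopfHeapType k) (M : hopfHeapModType H) (x : H).

Definition coinv_pred : {pred M} := fun m => coact m == x ⊗ m.

Fact coinv_submod : submod_closed coinv_pred.
Proof.
split=> [|a m n /eqP cm /eqP cn]; apply/eqP.
  by rewrite linear0 -(scale0r (0 : M)) tensZr scale0r.
by rewrite linearP cm cn (tens_bilinear H M).2.
Qed.

HB.instance Definition _ :=
  GRing.isSubmodClosed.Build k M coinv_pred coinv_submod.

(* The subspace of the m such that coact m = x ⊗ m, as a vector space. *)
Record coinv := Coinv { coinv_val : M; _ : coinv_pred coinv_val }.

HB.instance Definition _ := [isSub for coinv_val].
HB.instance Definition _ := [Choice of coinv by <:].
HB.instance Definition _ := [SubChoice_isSubLmodule of coinv by <:].

Lemma coinvP (m : coinv) : coact (coinv_val m) = x ⊗ coinv_val m.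
Proof. by apply/eqP; case: m. Qed.

End Coinvariants.

Section HeapTheory.
Variables (k : fieldType) (H : hopfHeapType k).

Lemma linear_bracket1 (X : lmodType k) (f : X -> H) (b c : H) :
  linear f -> linear (fun x => ⟦f x, b, c⟧).
Proof.
move=> fL; apply: (linear_comp (f := heap_op)
  (g := fun x => (f x ⊗ (b : cop H)) ⊗ c)); first exact: linear_fun.
by apply: linear_tensl; apply: linear_tensl.
Qed.

Lemma linear_bracket2 (X : lmodType k) (f : X -> H) (a c : H) :
  linear f -> linear (fun x => ⟦a, f x, c⟧).
Proof.
move=> fL; apply: (linear_comp (f := heap_op)
  (g := fun x => (a ⊗ (f x : cop H)) ⊗ c)); first exact: linear_fun.
by apply: linear_tensl; apply: linear_tensr.
Qed.

Lemma linear_bracket3 (X : lmodType k) (f : X -> H) (a b : H) :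
  linear f -> linear (fun x => ⟦a, b, f x⟧).
Proof.
move=> fL; apply: (linear_comp (f := heap_op)
  (g := fun x => (a ⊗ (b : cop H)) ⊗ f x)); first exact: linear_fun.
exact: linear_tensr.
Qed.

Lemma heap_op_bilinear (W : lmodType k) (F : H -> H -> W) :
  is_bilinear F -> is_bilinear (fun x y => F (heap_op x) (heap_op y)).
Proof.
move=> FB; split=> z /=.
  exact: (linear_comp (FB.1 _) (linear_fun heap_op)).
exact: (linear_comp (FB.2 _) (linear_fun heap_op)).
Qed.

Lemma comul_bracket (c d l : H) :
  comul ⟦c, d, l⟧ =
  \sw_(c1, c2 <- comul c) \sw_(d1, d2 <- comul d) \sw_(l1, l2 <- comul l)
    ⟦c1, d2, l1⟧ ⊗ ⟦c2, d1, l2⟧.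
Proof.
have TB : is_bilinear (fun x y : (H ⊗ cop H) ⊗ H => heap_op x ⊗ heap_op y).
  by apply: heap_op_bilinear; apply: tens_bilinear.
rewrite /heap_bracket heap_op_coalg.1 /tmap tensor_comulE //.
rewrite tensor_comulE; last first.
  split=> y /=; apply: linear_body => l1 l2.
    apply: (linear_comp (f := fun x => heap_op x ⊗ heap_op (y ⊗ l2))
      (g := fun x => x ⊗ l1)); [exact: TB.1 | lin].
  apply: (linear_comp (f := fun x => heap_op (y ⊗ l1) ⊗ heap_op x)
    (g := fun x => x ⊗ l2)); [exact: TB.2 | lin].
apply: eq_tlift => c1 c2; rewrite cop_comulE //.
split=> y /=; apply: linear_body => l1 l2.
  apply: (linear_comp (f := fun x => heap_op x ⊗ heap_op ((c2 ⊗ y) ⊗ l2))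
    (g := fun x => (c1 ⊗ x) ⊗ l1)); [exact: TB.1 | lin].
apply: (linear_comp (f := fun x => heap_op ((c1 ⊗ y) ⊗ l1) ⊗ heap_op x)
  (g := fun x => (c2 ⊗ x) ⊗ l2)); [exact: TB.2 | lin].
Qed.

End HeapTheory.

(* H ⊗ N with action (h ⊗ g) ▷ (l ⊗ n) = [h, g, l] ⊗ n and coaction
   h ⊗ n |-> h1 ⊗ h2 ⊗ n, for an arbitrary vector space N; this becomes the
   canonical left H-Hopf heap module structure on H ⊗ N. *)
Section FreeModule.
Variables (k : fieldType) (H : hopfHeapType k) (N : lmodType k).

Definition free_coact (t : H ⊗ N) : H ⊗ (H ⊗ N) :=
  \sw_(h, n <- t) \sw_(h1, h2 <- comul h) h1 ⊗ (h2 ⊗ n).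

Definition free_act (s : (H ⊗ cop H) ⊗ (H ⊗ N)) : H ⊗ N :=
  \sw_(y, t <- s) \sw_(h, g <- y) \sw_(l, n <- t) ⟦h, (g : H), l⟧ ⊗ n.

Fact free_coact_linear : linear free_coact.
Proof. by apply: tlift_linear; lin. Qed.

Lemma bracket_bilin (n : N) (l : H) :
  is_bilinear (fun (h : H) (g : cop H) => ⟦h, (g : H), l⟧ ⊗ n).
Proof. split=> ? /=; apply: linear_tensl; [exact: linear_bracket1 | exact: linear_bracket2]. Qed.

Fact free_act_linear : linear free_act.
Proof.
apply: tlift_linear; split=> [t|y] /=.
  apply: linear_arg => [g|h|] //=; apply: linear_body => l n;
    apply: linear_tensl.
    exact: linear_bracket1.
  exact: linear_bracket2.
apply: linear_body => h g; apply: linear_arg => [n|l|] //=.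
  by apply: linear_tensl; apply: linear_bracket3.
exact: linear_tensr.
Qed.

HB.instance Definition _ := GRing.isLinear.Build k (H ⊗ N)%type
  (H ⊗ (H ⊗ N))%type *:%R free_coact free_coact_linear.

HB.instance Definition _ := GRing.isLinear.Build k
  ((H ⊗ cop H) ⊗ (H ⊗ N))%type (H ⊗ N)%type *:%R free_act free_act_linear.

Lemma free_coactE h n :
  free_coact (h ⊗ n) = \sw_(h1, h2 <- comul h) h1 ⊗ (h2 ⊗ n).
Proof. by rewrite /free_coact tliftE //; lin. Qed.

Lemma free_actE (h g l : H) (n : N) :
  heap_act free_act h g (l ⊗ n) = ⟦h, g, l⟧ ⊗ n.
Proof.
rewrite /heap_act /free_act tliftE.
  rewrite tliftE; first rewrite tliftE //.
    split=> ? /=; last exact: linear_tensr.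
    by apply: linear_tensl; apply: linear_bracket3.
  split=> ? /=; apply: linear_body => *; apply: linear_tensl.
    exact: linear_bracket1.
  exact: linear_bracket2.
split=> [t|y] /=.
  apply: linear_arg => [b|a|] //=; apply: linear_body => *;
    apply: linear_tensl.
    exact: linear_bracket1.
  exact: linear_bracket2.
apply: linear_body => a b; apply: linear_arg => [n'|l'|] //=.
  by apply: linear_tensl; apply: linear_bracket3.
exact: linear_tensr.
Qed.

Fact free_coactA (t : H ⊗ N) :
  \sw_(h, n <- free_coact t) \sw_(h1, h2 <- comul h) h1 ⊗ (h2 ⊗ n) =
  \sw_(h, n <- free_coact t) h ⊗ free_coact n.
Proof.
move: t; apply: tensor_ext => [||h n]; [lin| |].
  apply: linear_arg => [n|h|]; [lin| |exact: free_coact_linear].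
  by apply: linear_tensr; exact: free_coact_linear.
rewrite !free_coactE !tlift_tlift; [|split=> ? /=|lin].
- transitivity (\sw_(h1, h2 <- comul h) \sw_(h11, h12 <- comul h1)
      h11 ⊗ (h12 ⊗ (h2 ⊗ n))).
    by apply: eq_tlift => h1 h2; rewrite tliftE //; lin.
  rewrite (comulA (G := fun x y z => x ⊗ (y ⊗ (z ⊗ n)))); [|move=> *; lin..].
  apply: eq_tlift => h1 h2; rewrite tliftE.
    rewrite free_coactE (linear_tlift (h := fun x => h1 ⊗ x)) //; lin.
  split=> ? /=; first lin.
  by apply: linear_tensr; exact: free_coact_linear.
- by lin.
- by apply: linear_tensr; exact: free_coact_linear.
Qed.

Fact free_counit_coact (t : H ⊗ N) :
  \sw_(h, n <- free_coact t) counit h *: n = t.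
Proof.
move: t; apply: tensor_ext => [||h n]; [|lin|].
  apply: linear_arg => [n|h|]; [lin|lin|exact: free_coact_linear].
rewrite free_coactE tlift_tlift; last by lin.
rewrite -{2}(counitl h) (linear_tlift (h := fun x => x ⊗ n)); last by lin.
by apply: eq_tlift => h1 h2; rewrite tliftE ?tensZl //; lin.
Qed.

HB.instance Definition _ := isComodule.Build k H (H ⊗ N)%type
  free_coactA free_counit_coact.

Lemma free_heap_act_linear (h g : H) : linear (heap_act free_act h g).
Proof.
apply: (linear_comp (f := free_act) (g := fun x => (h ⊗ (g : cop H)) ⊗ x)).
  exact: free_act_linear.
exact: linear_tensr.
Qed.

Fact free_actA (a b c d : H) (t : H ⊗ N) :
  heap_act free_act ⟦a, b, c⟧ d t = heap_act free_act a b (heap_act free_act c d t).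
Proof.
move: t; apply: tensor_ext => [||l n]; first exact: free_heap_act_linear.
  exact: (linear_comp (free_heap_act_linear a b) (free_heap_act_linear c d)).
by rewrite !free_actE heapA.
Qed.

Fact free_act_counit (c : H) (t : H ⊗ N) :
  \sw_(c1, c2 <- comul c) heap_act free_act c1 c2 t = counit c *: t.
Proof.
move: t; apply: tensor_ext => [||l n]; [|lin|].
  by apply: linear_body => c1 c2; exact: free_heap_act_linear.
rewrite -tensZl -heapl (linear_tlift (h := fun x => x ⊗ n)); last by lin.
by apply: eq_tlift => c1 c2; rewrite free_actE.
Qed.

Fact free_coact_act (c d : H) (t : H ⊗ N) :
  free_coact (heap_act free_act c d t) =
  \sw_(c1, c2 <- comul c) \sw_(d1, d2 <- comul d)
    \sw_(h, n <- free_coact t) ⟦c1, d2, h⟧ ⊗ heap_act free_act c2 d1 n.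
Proof.
have B c1 c2 d1 d2 : is_bilinear (fun (h : H) (n : H ⊗ N) =>
    ⟦c1, d2, h⟧ ⊗ heap_act free_act c2 d1 n).
  split=> ? /=; first by apply: linear_tensl; apply: linear_bracket3.
  by apply: linear_tensr; exact: free_heap_act_linear.
move: t; apply: tensor_ext => [||l n].
- exact: (linear_comp free_coact_linear (free_heap_act_linear c d)).
- apply: linear_body => c1 c2; apply: linear_body => d1 d2.
  apply: (linear_comp (f := tlift _)); last exact: free_coact_linear.
  exact: tlift_linear.
rewrite free_actE !free_coactE comul_bracket tlift_tlift; last by lin.
apply: eq_tlift => c1 c2; rewrite tlift_tlift; last by lin.
apply: eq_tlift => d1 d2; rewrite !tlift_tlift //; last by lin.
apply: eq_tlift => l1 l2; rewrite !tliftE ?free_actE //; lin.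
Qed.

HB.instance Definition _ := isHopfHeapModule.Build k H (H ⊗ N)%type
  free_actA free_act_counit free_coact_act.

Lemma coact_tensE (h : H) (n : N) :
  coact (h ⊗ n) = \sw_(h1, h2 <- comul h) h1 ⊗ (h2 ⊗ n) :> H ⊗ (H ⊗ N).
Proof. exact: free_coactE. Qed.

Lemma act_tensE (h g l : H) (n : N) :
  heap_act act h g (l ⊗ n) = ⟦h, g, l⟧ ⊗ n :> H ⊗ N.
Proof. exact: free_actE. Qed.

End FreeModule.

(* Main.v *)
(** The isomorphism is [h ⊗ m |-> (h ⊗ x) ▷ m].  Its inverse is
    [m |-> m_(-1) ⊗ E m_(0)], where [E m = (x ⊗ m_(-1)) ▷ m_(0)] is coinvariant
    because [[x, c_1, c_2] = ε(c) x].  That the two maps are mutually inverse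
    reduces to [[h, x, x] = h] for group-like [x], to
    [(c_1 ⊗ c_2) ▷ m = ε(c) m], and to [E ((h ⊗ x) ▷ m) = ε(h) m] for
    coinvariant [m]. *)

From HB Require Import structures.
Require Import Defs.
From mathcomp Require Import all_boot all_order all_algebra.

Set Implicit Arguments.
Unset Strict Implicit.
Unset Printing Implicit Defensive.

Import GRing.Theory.
Local Open Scope ring_scope.

(** The axiom [coactA_subproof] is an equality in [H ⊗ (H ⊗ M)]. Applying the linear map induced
    there by a trilinear [G] carries coassociativity over to every Sweedler sum with summand [G]. *)
Lemma coactA (k : fieldType) (H : coalgType k) (M : comodType H)
    (W : lmodType k) (G : H -> H -> M -> W) (m : M) :
  (forall b n, linear (fun a => G a b n)) ->
  (forall a n, linear (fun b => G a b n)) ->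
  (forall a b, linear (G a b)) ->
  \sw_(h, n <- coact m) \sw_(h1, h2 <- comul h) G h1 h2 n =
  \sw_(h, n <- coact m) \sw_(h', n' <- coact n) G h h' n'.
Proof.
move=> G1 G2 G3.
have BG a : is_bilinear (G a) by split=> b; [exact: G2 | exact: G3].
have BL : is_bilinear (fun a => tlift (G a)).
  split=> [t|a]; last exact: tlift_linear.
  by apply: linear_body => b n; apply: G1.
have LL := tlift_linear BL.
rewrite -[RHS](eq_tlift (f := fun h n =>
  tlift (fun a => tlift (G a)) (h ⊗ coact n))); last first.
  by move=> h n; rewrite tliftE.
rewrite -(linear_tlift _ _ LL) -coactA_subproof (linear_tlift _ _ LL).
apply: eq_tlift => h n; rewrite (linear_tlift _ _ LL).
by apply: eq_tlift => h1 h2; rewrite !tliftE.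
Qed.

Section HeapModuleTheory.
Variables (k : fieldType) (H : hopfHeapType k) (M : hopfHeapModType H).

Lemma linear_act1 (X : lmodType k) (f : X -> H) (b : H) (m : M) :
  linear f -> linear (fun y => heap_act act (f y) b m).
Proof.
move=> fL; apply: (linear_comp (f := act)
  (g := fun y => (f y ⊗ (b : cop H)) ⊗ m)); first exact: linear_fun.
by apply: linear_tensl; apply: linear_tensl.
Qed.

Lemma linear_act2 (X : lmodType k) (f : X -> H) (a : H) (m : M) :
  linear f -> linear (fun y => heap_act act a (f y) m).
Proof.
move=> fL; apply: (linear_comp (f := act)
  (g := fun y => (a ⊗ (f y : cop H)) ⊗ m)); first exact: linear_fun.
by apply: linear_tensl; apply: linear_tensr.
Qed.

Lemma linear_act3 (X : lmodType k) (f : X -> M) (a b : H) :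
  linear f -> linear (fun y => heap_act act a b (f y)).
Proof.
move=> fL; apply: (linear_comp (f := act)
  (g := fun y => (a ⊗ (b : cop H)) ⊗ f y)); first exact: linear_fun.
exact: linear_tensr.
Qed.

Lemma bracket_group_like (x h : H) : group_like x -> ⟦h, x, x⟧ = h.
Proof.
move=> [cx ex]; have := heapr x h; rewrite cx ex scale1r tliftE //; split=> a /=; first exact: linear_bracket2 (@linear_id _ _).
exact: linear_bracket3 (@linear_id _ _).
Qed.

Lemma act_group_like (x : H) (m : M) :
  group_like x -> heap_act act x x m = m.
Proof.
move=> [cx ex]; have := act_counit x m; rewrite cx ex scale1r tliftE //; split=> a /=; first exact: linear_act1 (@linear_id _ _).
exact: linear_act2 (@linear_id _ _).
Qed.

End HeapModuleTheory.

Section Decomposition.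
Variables (k : fieldType) (H : hopfHeapType k) (M : hopfHeapModType H) (x : H).
Hypothesis xG : group_like x.

Let act_bilin (c : H) : is_bilinear (fun (h : H) (n : M) => heap_act act c h n).
Proof.
split=> a /=; first exact: linear_act2 (@linear_id _ _).
exact: linear_act3 (@linear_id _ _).
Qed.

(** This is the map E. When H is a Hopf algebra, x = 1 and (a ⊗ b) ▷ m = a S(b) m, it is the
    classical projection m ↦ S(m_(-1)) m_(0) onto the coinvariants of a Hopf module. *)
Definition coinv_proj (m : M) : M :=
  \sw_(h, n <- coact m) heap_act act x h n.

Lemma coinv_proj_linear : linear coinv_proj.
Proof.
apply: (linear_comp (f := tlift _)); last exact: linear_fun.
exact: tlift_linear.
Qed.

(** Compatibility of ρ with ▷ gives ρ(E m) = [x, m_(-2), m_(-1)] ⊗ (x ⊗ m_(-3)) ▷ m_(0), and [heapr]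
    collapses the bracket to a multiple of x. *)
Lemma coinv_projP (m : M) : coinv_pred x (coinv_proj m).
Proof.
have bracketB a b : is_bilinear (fun (h : H) (n : M) =>
    ⟦x, a, h⟧ ⊗ heap_act act x b n).
  split=> c /=.
    by apply: linear_tensl; exact: linear_bracket3 (@linear_id _ _).
  by apply: linear_tensr; exact: linear_act3 (@linear_id _ _).
apply/eqP; rewrite /coinv_proj !(linear_tlift _ _ (linear_fun _)).
transitivity (\sw_(h, n <- coact m) \sw_(h1, h2 <- comul h)
    \sw_(h', n' <- coact n) ⟦x, h2, h'⟧ ⊗ heap_act act x h1 n').
  apply: eq_tlift => h n; rewrite coact_act xG.1 tliftE //.
  split=> c /=; do 2!apply: linear_body => ? ?.
    by apply: linear_tensl; exact: linear_bracket1 (@linear_id _ _).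
  by apply: linear_tensr; exact: linear_act1 (@linear_id _ _).
(* First use of coassociativity: the leg [h2] stops being a half of [h] and becomes a coaction leg,
   next to [h']. *)
rewrite (coactA (G := fun a b n =>
  \sw_(h', n' <- coact n) ⟦x, b, h'⟧ ⊗ heap_act act x a n')) => [|b n|a n|a b].
- rewrite (linear_tlift _ _ (linear_tensr _ (@linear_id _ _))).
  apply: eq_tlift => h n.
  (* Second use, backwards: the two legs inside the bracket become the comultiplication of a single
     element, the form that [heapr] needs. *)
  rewrite -(coactA (G := fun a b n =>
    ⟦x, a, b⟧ ⊗ heap_act act x h n)) => [|b p|a p|a b]; first last.
  + by case: (bracketB a h).
  + by case: (bracketB a h).
  + by apply: linear_tensl; exact: linear_bracket2 (@linear_id _ _).
  (* The scalar from [heapr] is moved onto the module element, where [counit_coact] absorbs it. *)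
  transitivity (\sw_(a, p <- coact n) x ⊗ heap_act act x h (counit a *: p)).
    apply: eq_tlift => a p.
    rewrite -(linear_tlift (h := fun y => y ⊗ heap_act act x h p));
      last exact: linear_tensl (@linear_id _ _).
    rewrite heapr tensZl -tensZr; congr (_ ⊗ _).
    by rewrite (scalable_linear (linear_act3 _ _ (@linear_id _ _))).
  rewrite -(linear_tlift (h := fun y => x ⊗ heap_act act x h y)).
    by rewrite counit_coact.
  by apply: linear_tensr; exact: linear_act3 (@linear_id _ _).
- apply: linear_body => ? ?; apply: linear_tensr.
  exact: linear_act2 (@linear_id _ _).
- apply: linear_body => ? ?; apply: linear_tensl.
  exact: linear_bracket2 (@linear_id _ _).
- apply: (linear_comp (f := tlift _)); last exact: linear_fun.
  exact: tlift_linear.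
Qed.

Definition to_coinv (m : M) : coinv M x := Coinv (coinv_projP m).

Lemma to_coinv_linear : linear to_coinv.
Proof. by move=> a m n; apply: val_inj; rewrite linearP; apply: coinv_proj_linear. Qed.

Definition decomp (m : M) : H ⊗ coinv M x := tmap id to_coinv (coact m).

Definition recomp (t : H ⊗ coinv M x) : M :=
  \sw_(h, n <- t) heap_act act h x (coinv_val n).

Let recomp_bilin : is_bilinear
  (fun (h : H) (n : coinv M x) => heap_act act h x (coinv_val n)).
Proof.
split=> a /=; first exact: linear_act1 (@linear_id _ _).
by apply: linear_act3; exact: (linear_fun (val : {linear coinv M x -> M})).
Qed.

Let decomp_bilin : is_bilinear (fun (h : H) (m : M) => h ⊗ to_coinv m).
Proof.
split=> a /=; first exact: linear_tensl (@linear_id _ _).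
by apply: linear_tensr; exact: to_coinv_linear.
Qed.

Lemma decomp_linear : linear decomp.
Proof.
apply: (linear_comp (f := tmap id to_coinv)); last exact: linear_fun.
exact: tlift_linear.
Qed.

Lemma recomp_linear : linear recomp.
Proof. exact: tlift_linear. Qed.

HB.instance Definition _ := GRing.isLinear.Build k M (H ⊗ coinv M x)%type
  *:%R decomp decomp_linear.
HB.instance Definition _ := GRing.isLinear.Build k (H ⊗ coinv M x)%type M
  *:%R recomp recomp_linear.

Lemma recompE h n : recomp (h ⊗ n) = heap_act act h x (coinv_val n).
Proof. by rewrite /recomp tliftE. Qed.

(** Both halves of x and the coaction leg of [n] equal x, so the first tensor factor is [h_1, x, x]
    = h_1. *)
Lemma coact_act_coinv (h : H) (n : coinv M x) :
  coact (heap_act act h x (coinv_val n)) =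
  \sw_(h1, h2 <- comul h) h1 ⊗ heap_act act h2 x (coinv_val n).
Proof.
rewrite coact_act; apply: eq_tlift => h1 h2; rewrite xG.1 coinvP.
rewrite tliftE.
  rewrite tliftE; first by rewrite bracket_group_like.
  split=> a /=.
    by apply: linear_tensl; exact: linear_bracket3 (@linear_id _ _).
  by apply: linear_tensr; exact: linear_act3 (@linear_id _ _).
split=> a /=; apply: linear_body => ? ?.
  by apply: linear_tensr; exact: linear_act2 (@linear_id _ _).
by apply: linear_tensl; exact: linear_bracket2 (@linear_id _ _).
Qed.

(** E((h ⊗ x) ▷ n) = (x ⊗ h_1) ▷ ((h_2 ⊗ x) ▷ n) = ([x, h_1, h_2] ⊗ x) ▷ n = ε(h) (x ⊗ x) ▷ n, and x
    ⊗ x acts trivially. *)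
Lemma to_coinv_act (h : H) (n : coinv M x) :
  to_coinv (heap_act act h x (coinv_val n)) = counit h *: n.
Proof.
apply: val_inj; rewrite linearZ /= /coinv_proj coact_act_coinv tlift_tlift //.
transitivity (\sw_(h1, h2 <- comul h)
    heap_act act ⟦x, h1, h2⟧ x (coinv_val n)).
  by apply: eq_tlift => h1 h2; rewrite tliftE // actA.
have L : linear (fun y => heap_act act y x (coinv_val n)).
  exact: linear_act1 (@linear_id _ _).
by rewrite -(linear_tlift _ _ L) heapr (scalable_linear L) act_group_like.
Qed.

Lemma recompK : cancel recomp decomp.
Proof.
apply: tensor_ext => [||h n]; last rewrite recompE.
- exact: (linear_comp decomp_linear recomp_linear).
- exact: linear_id.
rewrite /decomp /tmap coact_act_coinv tlift_tlift //.
transitivity (\sw_(h1, h2 <- comul h) (counit h2 *: h1) ⊗ n).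
  by apply: eq_tlift => h1 h2; rewrite tliftE // to_coinv_act tensZl tensZr.
by rewrite -(linear_tlift _ _ (linear_tensl _ (@linear_id _ _))) counitr.
Qed.

Lemma decompK : cancel decomp recomp.
Proof.
move=> m; rewrite /decomp /tmap (linear_tlift _ _ recomp_linear).
transitivity (\sw_(h, n <- coact m) \sw_(h', n' <- coact n)
    heap_act act h h' n').
  apply: eq_tlift => h n; rewrite recompE /= /coinv_proj.
  rewrite (linear_tlift _ _ (linear_act3 _ _ (@linear_id _ _))).
  (* The two actions merge through [h, x, x] = h, so x disappears. *)
  by apply: eq_tlift => h' n'; rewrite -actA bracket_group_like.
(* Coassociativity turns the two coaction legs into halves of one element, which act by its
   counit. *)
rewrite -coactA => [|b n|a n|a b].
- rewrite -[RHS](counit_coact m); apply: eq_tlift => h n.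
  exact: act_counit.
- exact: linear_act1 (@linear_id _ _).
- exact: linear_act2 (@linear_id _ _).
- exact: linear_act3 (@linear_id _ _).
Qed.

Lemma recomp_morphism :
  hopf_heap_mod_morphism (recomp : {linear (H ⊗ coinv M x)%type -> M}).
Proof.
have idB : is_bilinear (fun (h : H) (t : H ⊗ coinv M x) => h ⊗ recomp t).
  split=> a /=; first exact: linear_tensl (@linear_id _ _).
  by apply: linear_tensr; exact: recomp_linear.
split=> [|a b].
  apply: tensor_ext => [||h n].
  - by apply: linear_comp (linear_fun _) _; exact: recomp_linear.
  - apply: (linear_comp (f := tmap id recomp)); last exact: linear_fun.
    exact: tlift_linear.
  rewrite /= recompE coact_act_coinv coact_tensE /tmap tlift_tlift //.
  by apply: eq_tlift => h1 h2; rewrite tliftE // recompE.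
apply: tensor_ext => [||h n].
- apply: linear_comp; first exact: recomp_linear.
  exact: linear_act3 (@linear_id _ _).
- by apply: linear_act3; exact: recomp_linear.
by rewrite /= act_tensE !recompE actA.
Qed.

End Decomposition.

(** This spares a direct check for [decomp]: only [recomp], with its simpler formula, is verified to
    be a morphism. *)
Lemma cancel_morphism (k : fieldType) (H : hopfHeapType k)
    (M N : hopfHeapModType H) (f : {linear M -> N}) (g : {linear N -> M}) :
  hopf_heap_mod_morphism f -> cancel f g -> cancel g f ->
  hopf_heap_mod_morphism g.
Proof.
move=> [fc fa] fK gK; split=> [n|a b n]; last by rewrite -{1}[n]gK -fa fK.
have gB : is_bilinear (fun (h : H) (y : N) => h ⊗ g y).
  split=> a /=; first exact: linear_tensl (@linear_id _ _).
  by apply: linear_tensr; exact: linear_fun.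
have fB : is_bilinear (fun (h : H) (m : M) => \sw_(h', y <- h ⊗ f m) h' ⊗ g y).
  split=> a /=; apply: (linear_comp (tlift_linear gB)).
    exact: linear_tensl (@linear_id _ _).
  by apply: linear_tensr; exact: linear_fun.
(* With n = f (g n) on the right, colinearity of [f] reduces the goal to (id ⊗ g)(id ⊗ f) = id on
   ρ(g n). *)
rewrite -{2}[n]gK fc /tmap tlift_tlift //.
move: (coact (g n)); apply: tensor_ext => [||h m].
- exact: linear_id.
- exact: tlift_linear.
by rewrite tliftE // tliftE // fK.
Qed.

Theorem theorem4p6 (k : fieldType) (H : hopfHeapType k)
    (M : hopfHeapModType H) (x : H) :
  group_like x -> hopf_heap_mod_isomorphic M (H ⊗ coinv M x)%type.
Proof.
move=> xG; have rM := recomp_morphism M xG.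
exists (decomp xG), (recomp (M := M) (x := x)); split=> //.
- by apply: (cancel_morphism rM); [exact: recompK | exact: decompK].
- exact: decompK.
- exact: recompK.
Qed.
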